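(* Suppose $(X_t)_{0\le t<\tau_\partial}$ has a QSD $\pi\in\mathcal P_\infty(\Lambda)$ and that a submarkovian transition semigroup $(\tilde P_t)_{t\ge0}$ satisfies Assumption (C). Then: (1) For any open set $V\subseteq\chi$ such that, for every $t\ge0$ and every bounded continuous $f$ on $\chi$, $\tilde P_tf$ is a bounded Borel function whose restriction to $V$ is continuous, the density $\frac{d\pi}{d\Lambda}$ has a version whose restriction to $V$ is bounded and continuous. (2) If instead $(\tilde P_t)_{t\ge0}$ is lower semicontinuous (i.e. $\tilde P_tf$ is lower semicontinuous for every $t\ge0$ and every bounded continuous $f\ge0$) and $\chi$ is separable, then $\frac{d\pi}{d\Lambda}$ has a bounded, non-negative, lower semicontinuous version $\rho$ which is maximal: every bounded non-negative lower semicontinuous version $\tilde\rho$ of $\frac{d\pi}{d\Lambda}$ satisfies $\tilde\rho(x)\le\rho(x)$ for all $x\in\chi$.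
   Context: $\chi$ is a metric space with Borel $\sigma$-algebra and a distinguished $\sigma$-finite Borel measure $\Lambda$ of full support. $(X_t)_{0\le t<\tau_\partial}$ is a killed Markov process on $\chi$ with absorption time $\tau_\partial$ and submarkovian semigroup $P_t(x,A)=\mathbb P_x(X_t\in A,\tau_\partial>t)$; $K1(x)=K(x,\chi)$. A QSD is $\pi\in\mathcal P(\chi)$ with $\mathbb P_\pi(X_t\in\cdot\mid\tau_\partial>t)=\pi$ for all $t$. $\mathcal P_\infty(\Lambda)$ = probability measures $\ll\Lambda$ with density in $L^\infty(\Lambda)$. $C_{b,\gg}(\chi)$ = bounded continuous functions with positive infimum; $\Lambda|_{\mathcal O}$ is the restriction of $\Lambda$ to $\mathcal O$. Assumption (C) on $(\tilde P_t)$: there exist $\psi\in C_{b,\gg}(\chi)$ and $a>0$ with $\psi(x)\Lambda(dx)P_t(x,dy)=a^t\psi(y)\Lambda(dy)\tilde P_t(y,dx)$ as measures on $\chi\times\chi$ for all $t\ge0$; for all $t>0$, $\tilde P_t1(y)>0$ for $\Lambda$-a.e. $y$; there exist $c_0>0$, $t_0>0$, $\nu\in\mathcal P(\chi)$ with $\tilde P_{t_0}(y,\cdot)/\tilde P_{t_0}1(y)\ge c_0\nu$ for $\Lambda$-a.e. $y$; and there exist an open set $\mathcal O$, $c_1>0$ and $t_1>0$ with $\pi\ge c_1\Lambda|_{\mathcal O}$ and $\nu\tilde P_{t_1}(\mathcal O)>0$. *)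

(* Defs.v *)
From HB Require Import structures.
From mathcomp Require Import all_boot all_order all_algebra.
From mathcomp Require Import all_classical all_reals all_analysis.
Set Implicit Arguments. Unset Strict Implicit. Unset Printing Implicit Defensive.
Import Order.TTheory GRing.Theory Num.Theory.
Import numFieldNormedType.Exports.
Local Open Scope classical_set_scope.
Local Open Scope ring_scope.

(* The state space chi: a (pseudo)metric space T (Hausdorff is assumed in the
   theorem, making it a metric space), equipped with its Borel sigma-algebra,
   i.e. the sigma-algebra generated by the open sets. *)
Definition Borel (R : realType) (T : pseudoPMetricType R) :=
  g_sigma_algebraType (@open T).

Section defs.
Context (R : realType) (T : pseudoPMetricType R).
Local Notation B := (Borel T).

Definition full_support (L : {measure set B -> \bar R}) :=
  forall U : set T, open U -> U !=set0 -> (0 < L U)%E.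

Definition kact (k : B -> {measure set B -> \bar R}) (f : T -> R) : T -> R :=
  fun y => fine (\int[k y]_x (f x)%:E).

Definition mP (mu : {measure set B -> \bar R}) (k : B -> {measure set B -> \bar R})
  (A : set B) : \bar R := (\int[mu]_x k x A)%E.

Definition submarkov_semigroup (P : R -> R.-spker B ~> B) :=
  (forall (x : B) (A : set B), measurable A -> P 0 x A = \d_x A) /\
  (forall s t, 0 <= s -> 0 <= t -> forall (x : B) (A : set B), measurable A ->
     P (s + t) x A = (\int[P s x]_y P t y A)%E).

(* pi is a QSD: P_pi(X_t in A | tau > t) = pi(A) for all t >= 0, with
   P_pi(X_t in A, tau > t) = (pi P_t)(A). *)
Definition is_QSD (P : R -> R.-spker B ~> B) (pi : probability B R) :=
  forall t, 0 <= t ->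
    (0 < mP pi (P t) setT)%E /\
    forall A : set B, measurable A ->
      fine (mP pi (P t) A) / fine (mP pi (P t) setT) = fine (pi A).

Definition density_version (L : {measure set B -> \bar R}) (pi : probability B R)
  (g : T -> R) :=
  measurable_fun [set: B] (g : B -> R) /\
  forall A : set B, measurable A -> pi A = (\int[L]_(x in A) (g x)%:E)%E.

Definition in_P_infty (L : {measure set B -> \bar R}) (pi : probability B R) :=
  exists f : T -> R, density_version L pi f /\
    exists M : R, {ae L, forall x, `|f x| <= M}.

Definition bounded_on (f : T -> R) (V : set T) := exists M : R, forall x, V x -> `|f x| <= M.

Definition bounded_continuous (f : T -> R) := continuous f /\ bounded_on f setT.

Definition lsc (f : T -> R) := lower_semicontinuous (fun x => (f x)%:E).

Definition separable := exists D : set T, countable D /\ dense D.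

Definition assumption_C (L : {measure set B -> \bar R})
  (P Pt : R -> R.-spker B ~> B) (pi : probability B R) :=
  (exists (psi : T -> R) (a : R),
    (bounded_continuous psi /\ exists c : R, 0 < c /\ forall x, c <= psi x) /\
    0 < a /\
    (* psi(x)L(dx)P_t(x,dy) = a^t psi(y)L(dy)Pt_t(y,dx) on chi x chi *)
    (forall t, 0 <= t -> forall C : set (B * B), measurable C ->
      (\int[L]_x ((psi x)%:E * \int[P t x]_y (\1_C (x, y))%:E)
       = (a `^ t)%:E * \int[L]_y ((psi y)%:E * \int[Pt t y]_x (\1_C (x, y))%:E))%E))
  /\
  (forall t, 0 < t -> {ae L, forall y : B, (0 < Pt t y setT)%E})
  /\
  (exists (c0 t0 : R) (nu : probability B R), 0 < c0 /\ 0 < t0 /\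
     {ae L, forall y : B, forall A : set B, measurable A ->
        c0 * fine (nu A) <= fine (Pt t0 y A) / fine (Pt t0 y setT)}
   /\
   exists (O : set T) (c1 t1 : R), open O /\ 0 < c1 /\ 0 < t1 /\
     (forall A : set B, measurable A -> (c1%:E * L (A `&` O) <= pi A)%E) /\
     (0 < mP nu (Pt t1) O)%E).

End defs.

(* Main.v *)
Require Import Defs.
From HB Require Import structures.
From mathcomp Require Import all_boot all_order all_algebra.
From mathcomp Require Import all_classical all_reals all_analysis.
From mathcomp Require Import measurable_realfun ring lra.
Import Order.TTheory GRing.Theory Num.Theory.
Import numFieldNormedType.Exports.
Local Open Scope classical_set_scope.
Local Open Scope ring_scope.

(* Duality turns the quasi-stationary density f into an eigenfunction h = f / psi
   of the dual kernel K = Pt_{t0}: K h = kappa h almost everywhere. The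
   minorization K(y, .) >= c0 K1(y) nu forces nu << Lambda and, as
   f >= c1 > 0 on the open set charged by nu Pt_{t1}, also nu(h) > 0. Hence if
   m h <= u <= M h almost everywhere, the minorization applied to u - m h and to
   M h - u narrows the same bracket for K u / kappa by the factor
   1 - (c0 / H) nu(h), where H bounds h. Starting from u = 1, the functions
   kappa^-n K^n 1, up to scaling, converge to h uniformly outside a null set, so
   f is an almost everywhere uniform limit of functions alpha psi Pt_s 1.

   In (1) these functions are continuous on V, and since Lambda has full support
   they are uniformly Cauchy everywhere on V. In (2) each of them, lowered by its
   error, is a lower semicontinuous minorant of f, so f is also reached by its
   largest lower semicontinuous minorant. *)

(** * Integration against mixtures of kernels *)

Section mixture.
Context {d} {T : measurableType d} {R : realType}.
Local Open Scope ereal_scope.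

(** The integral of [g] against the measure $w(y) mu(dy) k(y, dx)$, kept as an iterated integral so
    that this measure is never constructed. *)
Definition mixture (mu : {measure set T -> \bar R}) (w : T -> \bar R)
  (k : T -> {measure set T -> \bar R}) (g : T -> \bar R) : \bar R :=
  \int[mu]_y (w y * \int[k y]_x g x).

Section mixture_theory.
Variables (mu : {measure set T -> \bar R}) (w : T -> \bar R)
  (k : T -> {measure set T -> \bar R}).
Hypothesis w0 : forall y, 0 <= w y.
Hypothesis wfin : forall y, w y \is a fin_num.
Hypothesis mw : measurable_fun [set: T] w.
Hypothesis mk : forall U, measurable U -> measurable_fun [set: T] (k ^~ U).

Let measurable_inner g : (forall x, 0 <= g x) -> measurable_fun setT g ->
  measurable_fun setT (fun y => w y * \int[k y]_x g x).
Proof.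
by move=> g0 mg; apply: emeasurable_funM => //; exact: measurable_fun_integral_kernel.
Qed.

Let inner_ge0 g : (forall x, 0 <= g x) -> forall y, 0 <= w y * \int[k y]_x g x.
Proof. by move=> g0 y; rewrite mule_ge0// integral_ge0. Qed.

Import HBNNSimple.

Lemma mixture_nnsfun (f : {nnsfun T >-> R}) :
  mixture mu w k (EFin \o f) =
  \sum_(r \in range f) r%:E * mixture mu w k (EFin \o \1_(f @^-1` [set r])).
Proof.
have mf r : measurable (f @^-1` [set r]) by exact: measurable_funPTI.
transitivity (\int[mu]_y
    (\sum_(r \in range f) r%:E * (w y * k y (f @^-1` [set r])))).
  apply: eq_integral => y _.
  rewrite integralT_nnsfun sintegralE ge0_mule_fsumr//.
    by apply: eq_fsbigr => r _; rewrite muleCA.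
  (* A negative [r] has an empty fibre under [f], so its term is zero and all summands are
     nonnegative. *)
  move=> r; have [r0|r0] := leP 0%R r; first by rewrite mule_ge0// lee_fin.
  by rewrite preimage_nnfun0// measure0 mule0.
have mwk r : measurable_fun setT (fun y => w y * k y (f @^-1` [set r])).
  by apply: emeasurable_funM => //; exact: mk.
have wk0 r y : 0 <= w y * k y (f @^-1` [set r]) by rewrite mule_ge0.
rewrite ge0_integral_fsum//=; first last.
- move=> r y _; have [r0|r0] := leP 0%R r; first by rewrite mule_ge0// lee_fin.
  by rewrite preimage_nnfun0// measure0 !mule0.
- by move=> r; apply: measurable_funeM.
apply: eq_fsbigr => r /set_mem[x _ <-].
rewrite ge0_integralZl//; last by rewrite lee_fin.
by congr (_ * _); apply: eq_integral => y _; rewrite integral_indic// setIT.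
Qed.

(** Monotone convergence is used twice, for the inner and then for the outer integral; finiteness of
    [w y] lets this factor pass through the inner limit. *)
Lemma mixture_cvg (g : nat -> T -> R) (f : T -> \bar R) :
  (forall n x, 0 <= g n x)%R -> (forall n, measurable_fun setT (g n)) ->
  (forall x, nondecreasing_seq (g ^~ x)) ->
  (forall x, (g n x)%:E @[n --> \oo] --> f x) ->
  mixture mu w k (EFin \o g n) @[n --> \oo] --> mixture mu w k f.
Proof.
move=> g0 mg ndg gf.
have inner_cvg y : \int[k y]_x (g n x)%:E @[n --> \oo] --> \int[k y]_x f x.
  rewrite (eq_integral (fun x => limn (fun n => (g n x)%:E))); last first.
    by move=> x _; apply/esym/cvg_lim => //; exact: gf.
  apply: cvg_monotone_convergence => //.
  - by move=> n; apply/measurable_EFinP.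
  - by move=> n x _; rewrite lee_fin.
  - by move=> x _ m n mn; rewrite lee_fin; exact: ndg.
have F_cvg y : w y * \int[k y]_x (g n x)%:E @[n --> \oo] --> w y * \int[k y]_x f x.
  exact: cvgeZl.
rewrite /mixture (eq_integral (fun y =>
    limn (fun n => w y * \int[k y]_x (g n x)%:E))); last first.
  by move=> y _; apply/esym/cvg_lim => //; exact: F_cvg.
apply: cvg_monotone_convergence => //.
- by move=> n; apply: measurable_inner => [x|]; [rewrite lee_fin|apply/measurable_EFinP].
- by move=> n y _; apply: inner_ge0 => x; rewrite lee_fin.
- move=> y _ m n mn; apply: lee_pmul => //; first by apply: integral_ge0 => x _; rewrite lee_fin.
  apply: ge0_le_integral => //=.
  + by move=> x _; rewrite lee_fin.
  + by apply/measurable_EFinP.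
  + by apply/measurable_EFinP.
  + by move=> x _; rewrite lee_fin; exact: ndg.
Qed.

Lemma mixture_approx (g : T -> \bar R) (mg : measurable_fun setT g) :
  (forall x, 0 <= g x) ->
  mixture mu w k (EFin \o nnsfun_approx measurableT mg n) @[n --> \oo] -->
    mixture mu w k g.
Proof.
move=> g0; apply: mixture_cvg => //.
- by move=> x m n mn; exact/lefP/nd_nnsfun_approx.
- by move=> x; exact: cvg_nnsfun_approx.
Qed.

End mixture_theory.

Import HBNNSimple.

(** Both sides are linear on simple functions and pass to increasing limits, so agreement on
    measurable sets is enough. *)
Lemma eq_mixture (mu1 mu2 : {measure set T -> \bar R}) (w1 w2 : T -> \bar R)
    (k1 k2 : T -> {measure set T -> \bar R}) :
  (forall y, 0 <= w1 y < +oo) -> measurable_fun setT w1 ->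
  (forall U, measurable U -> measurable_fun setT (k1 ^~ U)) ->
  (forall y, 0 <= w2 y < +oo) -> measurable_fun setT w2 ->
  (forall U, measurable U -> measurable_fun setT (k2 ^~ U)) ->
  (forall U, measurable U ->
    \int[mu1]_y (w1 y * k1 y U) = \int[mu2]_y (w2 y * k2 y U)) ->
  forall g, measurable_fun setT g -> (forall x, 0 <= g x) ->
  mixture mu1 w1 k1 g = mixture mu2 w2 k2 g.
Proof.
move=> w1b mw1 mk1 w2b mw2 mk2 eq12 g mg g0.
have w10 y : 0 <= w1 y by case/andP: (w1b y).
have w20 y : 0 <= w2 y by case/andP: (w2b y).
have w1f y : w1 y \is a fin_num by rewrite ge0_fin_numE//; case/andP: (w1b y).
have w2f y : w2 y \is a fin_num by rewrite ge0_fin_numE//; case/andP: (w2b y).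
have c1 := mixture_approx mu1 w1 k1 w10 w1f mw1 mk1 g mg g0.
have c2 := mixture_approx mu2 w2 k2 w20 w2f mw2 mk2 g mg g0.
pose h := nnsfun_approx measurableT mg.
suff E : (fun n => mixture mu1 w1 k1 (EFin \o h n)) =
         (fun n => mixture mu2 w2 k2 (EFin \o h n)).
  by rewrite -(cvg_lim _ c1)// -(cvg_lim _ c2)// E.
apply/funext => n; rewrite !mixture_nnsfun//; apply: eq_fsbigr => r _.
congr (_ * _); have mU : measurable (h n @^-1` [set r]).
  exact: measurable_funPTI.
rewrite /mixture; under eq_integral do rewrite integral_indic// setIT.
under [RHS]eq_integral do rewrite integral_indic// setIT.
exact: eq12.
Qed.

End mixture.

(** * Finiteness of kernels and indicators of rectangles *)

Lemma spker_lty {d} {T : measurableType d} {R : realType} (k : R.-spker T ~> T) x A :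
  measurable A -> (k x A < +oo)%E.
Proof.
move=> mA; apply: (@le_lt_trans _ _ 1%E); last exact: ltry.
by rewrite (le_trans _ (sprob_kernel_le1 k x))// le_measure// inE.
Qed.

Section integral_rectangle.
Context {d} {T : measurableType d} {R : realType}.
Local Open Scope ereal_scope.
Variables (mu : {measure set T -> \bar R}) (X A : set T).
Hypotheses (mX : measurable X) (mA : measurable A).

Lemma integral_rectangle_l y :
  \int[mu]_x (\1_(X `*` A) (x, y))%:E = (\1_A y)%:E * mu X.
Proof.
rewrite -[X in mu X]setIT -integral_indic// -ge0_integralZl_EFin//.
apply: eq_integral => x _.
by rewrite !indicE in_setX -EFinM -natrM mulnb andbC.
exact/measurable_EFinP.
Qed.

Lemma integral_rectangle_r x :
  \int[mu]_y (\1_(X `*` A) (x, y))%:E = (\1_X x)%:E * mu A.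
Proof.
rewrite -[X in mu X]setIT -integral_indic// -ge0_integralZl_EFin//.
apply: eq_integral => y _.
by rewrite !indicE in_setX -EFinM -natrM mulnb.
exact/measurable_EFinP.
Qed.
End integral_rectangle.

(** * Duality and the eigenfunction of the dual kernel *)

Section dual_eigenfunction.
Context {d} {T : measurableType d} {R : realType}.
Local Open Scope ereal_scope.

(** Dirac kernels make weighted integrals instances of [mixture], so [eq_mixture] can compare them
    with genuine iterated integrals. *)
Lemma mixture_dirac (mu : {measure set T -> \bar R}) (w g : T -> \bar R) :
  measurable_fun setT g ->
  mixture mu w (fun x => \d_x) g = \int[mu]_x (w x * g x).
Proof.
move=> mg; apply: eq_integral => x _.
by rewrite integral_dirac// diracE in_setT mul1e.
Qed.

Variables (L : {measure set T -> \bar R}) (pi : probability T R).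
Variable f : T -> R.
Hypothesis mf : measurable_fun setT f.
Hypothesis f0 : forall x, (0 <= f x)%R.
Hypothesis pif : forall A, measurable A -> pi A = \int[L]_(x in A) (f x)%:E.

Lemma integral_density g : measurable_fun setT g -> (forall x, 0 <= g x) ->
  \int[pi]_x g x = \int[L]_x ((f x)%:E * g x).
Proof.
move=> mg g0.
rewrite -(mixture_dirac L (EFin \o f))//.
transitivity (mixture pi (cst 1) (fun x => \d_x) g).
  by rewrite mixture_dirac//; apply: eq_integral => x _; rewrite mul1e.
apply: eq_mixture => //.
- by move=> y /=; rewrite lee_fin ltry ler01.
- by move=> U mU; exact: measurable_fun_dirac.
- by move=> y /=; rewrite lee_fin ltry f0.
- by apply/measurable_EFinP.
- by move=> U mU; exact: measurable_fun_dirac.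
- move=> U mU.
  rewrite (eq_integral (fun y => (\1_U y)%:E)); last first.
    by move=> y _ /=; rewrite mul1e diracE.
  rewrite integral_indic// setIT [LHS]pif// integral_mkcond.
  apply: eq_integral => x _ /=; rewrite diracE patchE/=.
  by case: ifP => _; rewrite ?mule1// mule0.
Qed.

Variables (P Q : R.-spker T ~> T) (psi h : T -> R) (a lambda : R).
Hypothesis mpsi : measurable_fun setT psi.
Hypothesis psi0 : forall x, (0 < psi x)%R.
Hypothesis mh : measurable_fun setT h.
Hypothesis h0 : forall x, (0 <= h x)%R.
Hypothesis fh : forall x, f x = (psi x * h x)%R.
Hypothesis a0 : (0 < a)%R.
Hypothesis duality : forall C : set (T * T), measurable C ->
  \int[L]_x ((psi x)%:E * \int[P x]_y (\1_C (x, y))%:E)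
  = a%:E * \int[L]_y ((psi y)%:E * \int[Q y]_x (\1_C (x, y))%:E).
Hypothesis quasi_stationary : forall A, measurable A ->
  \int[pi]_x P x A = lambda%:E * pi A.

(** Duality tested on [X] times [A], arranged so that [X] is the argument of a kernel on both sides
    (Dirac, then [Q]) and [A] is part of the weight: the form that [eq_mixture] expects. *)
Lemma duality_rectangle X A : measurable X -> measurable A ->
  \int[L]_x ((psi x)%:E * P x A * \d_x X)
  = \int[L]_y ((a * psi y * \1_A y)%:E * Q y X).
Proof.
move=> mX mA; have := duality (X `*` A) (measurableX mX mA).
under eq_integral do rewrite integral_rectangle_r// (muleC (\1_X _)%:E) muleA.
under [in X in _ = _ * X -> _]eq_integral do rewrite integral_rectangle_l//.
rewrite -ge0_integralZl//; last 3 first.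
- apply: emeasurable_funM; first exact/measurable_EFinP.
  by apply: emeasurable_funM; [exact/measurable_EFinP|exact: measurable_kernel].
- by move=> y _; rewrite !mule_ge0 ?lee_fin// ltW.
- by rewrite lee_fin ltW.
by under [in X in _ = X -> _]eq_integral do rewrite !muleA -!EFinM.
Qed.

(** For every measurable [A], quasi-stationarity and then duality turn [lambda] times the
    [L]-integral of [f] over [A] into that of [psi h P(., A)] and then into [a] times the integral
    of [psi Q h] over [A]. Since [A] is arbitrary, [lambda f = a psi Q h] almost everywhere, and
    [a psi] is divided out. *)
Lemma dual_eigenfunction : {ae L, forall y : T,
  \int[Q y]_x (h x)%:E = (lambda / a * h y)%:E}.
Proof.
have mQh : measurable_fun setT (fun y => \int[Q y]_x (h x)%:E).
  apply: measurable_fun_integral_kernel => //.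
  - exact: measurable_kernel.
  - exact/measurable_EFinP.
have fint : L.-integrable setT (EFin \o f).
  apply/integrableP; split; first exact/measurable_EFinP.
  under eq_integral do rewrite gee0_abs ?lee_fin//.
  by rewrite -pif// (le_lt_trans (probability_le1 _ _))// ltry.
have key A : measurable A -> \int[L]_(y in A) (lambda * f y)%:E =
    \int[L]_(y in A) ((a * psi y)%:E * \int[Q y]_x (h x)%:E).
  move=> mA; under eq_integral do rewrite EFinM.
  rewrite integralZl//; last exact: integrableS fint.
  rewrite -pif// -quasi_stationary// integral_density//; last exact: measurable_kernel.
  transitivity (mixture L (fun x => (psi x)%:E * P x A) (fun x => \d_x) (EFin \o h)).
    rewrite mixture_dirac//; last exact/measurable_EFinP.
    by apply: eq_integral => x _; rewrite fh EFinM muleAC.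
  (* For fixed [A] the two mixtures agree on every measurable set by [duality_rectangle], hence also
     on [h]. *)
  transitivity (mixture L (fun y => (a * psi y * \1_A y)%:E) Q (EFin \o h)).
    apply: eq_mixture => //.
    - move=> y; rewrite mule_ge0 ?lee_fin ?(ltW (psi0 _))//=.
      by rewrite lte_mul_pinfty// ?lee_fin ?(ltW (psi0 _))// spker_lty.
    - by apply: emeasurable_funM; [exact/measurable_EFinP|exact: measurable_kernel].
    - by move=> U mU; exact: measurable_fun_dirac.
    - by move=> y; rewrite ltry andbT lee_fin !mulr_ge0// ltW.
    - by apply/measurable_EFinP; do ! apply: measurable_funM.
    - exact: measurable_kernel.
    - by move=> U mU; exact: duality_rectangle.
    - exact/measurable_EFinP.
  rewrite [RHS]integral_mkcond; apply: eq_integral => y _ /=.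
  by rewrite patchE indicE; case: ifP => _; rewrite ?mulr1// mulr0 mul0e.
(* [f] is integrable because [pi] has mass one, so equal integrals over all measurable sets force
   equality almost everywhere. *)
have : ae_eq L setT (fun y => (lambda * f y)%:E)
    (fun y => (a * psi y)%:E * \int[Q y]_x (h x)%:E).
  apply: integral_ae_eq => //; last by move=> E _; exact: key.
    under [X in L.-integrable _ X]eq_fun do rewrite EFinM.
    exact: integrableZl fint.
  apply: emeasurable_funM => //.
  by apply/measurable_EFinP; exact: measurable_funM.
apply: filterS => y /(_ I).
have ap0 : (0 < a * psi y)%R by rewrite mulr_gt0.
move=> E; have : ((a * psi y)^-1)%:E * (lambda * f y)%:E = \int[Q y]_x (h x)%:E.
  by rewrite E muleA -EFinM mulVf ?mul1e// gt_eqF.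
move=> <-; rewrite -EFinM fh; congr _%:E; field.
by rewrite !gt_eqF.
Qed.
End dual_eigenfunction.

(** * Bounded measurable functions and their integrals *)

Definition bounded_measurable {d} {T : measurableType d} {R : realType} (g : T -> R) :=
  measurable_fun [set: T] g /\ exists M : R, forall x, `|g x| <= M.

Section bounded_measurable_theory.
Context {d} {T : measurableType d} {R : realType}.
Implicit Types (g : T -> R) (mu : {measure set T -> \bar R}).

Lemma bounded_measurable_cst (r : R) : bounded_measurable (fun _ : T => r).
Proof. by split => //; exists `|r|. Qed.

Lemma bounded_measurable_lin g1 g2 (s t : R) :
  bounded_measurable g1 -> bounded_measurable g2 ->
  bounded_measurable (fun x => s * g1 x + t * g2 x).
Proof.
move=> [m1 [M1 b1]] [m2 [M2 b2]]; split.
  by apply: measurable_funD; apply: measurable_funM.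
exists (`|s| * M1 + `|t| * M2) => x.
by rewrite (le_trans (ler_normD _ _))// !normrM lerD// ler_wpM2l.
Qed.

Lemma bounded_measurable_integrable mu g : (mu setT < +oo)%E ->
  bounded_measurable g -> mu.-integrable setT (EFin \o g).
Proof.
move=> mufin [mg [M gM]]; apply: measurable_bounded_integrable => //.
exists M; split; first exact: num_real.
by move=> x Mx y _ /=; rewrite (le_trans (gM y))// ltW.
Qed.

Lemma Rintegral_lin mu g1 g2 (s t : R) : (mu setT < +oo)%E ->
  bounded_measurable g1 -> bounded_measurable g2 ->
  (\int[mu]_x (s * g1 x + t * g2 x) = s * \int[mu]_x g1 x + t * \int[mu]_x g2 x)%R.
Proof.
move=> mufin b1 b2.
have i1 := bounded_measurable_integrable _ _ mufin b1.
have i2 := bounded_measurable_integrable _ _ mufin b2.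
rewrite RintegralD// ?RintegralZl//.
- apply: bounded_measurable_integrable => //.
  have := bounded_measurable_lin _ _ s 0 b1 b2.
  by under eq_fun do rewrite mul0r addr0.
- apply: bounded_measurable_integrable => //.
  have := bounded_measurable_lin _ _ 0 t b1 b2.
  by under eq_fun do rewrite mul0r add0r.
Qed.

Lemma ae_Rintegral_ge0 mu g : bounded_measurable g ->
  {ae mu, forall x, 0 <= g x} -> (0 <= \int[mu]_x g x)%R.
Proof.
move=> [mg _] g0; rewrite /Rintegral fine_ge0//.
rewrite (ae_eq_integral (fun x => (Num.max (g x) 0)%:E))//.
- by apply: integral_ge0 => x _; rewrite lee_fin le_max lexx orbT.
- exact/measurable_EFinP.
- by apply/measurable_EFinP; exact: measurable_maxr.
- by move: g0; apply: filterS => x gx0 _; congr _%:E; rewrite max_l.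
Qed.

End bounded_measurable_theory.

(** * Contraction from the minorization and convergence to the eigenfunction *)

Section doeblin.
Context {d} {T : measurableType d} {R : realType}.
Variables (L : {measure set T -> \bar R}) (Q : R.-spker T ~> T)
  (nu : probability T R) (c0 H kappa : R) (h : T -> R).
Hypothesis L_neq0 : (0 < L setT)%E.
Hypothesis c0_gt0 : 0 < c0.
Hypothesis minorization : {ae L, forall y, forall A, measurable A ->
  c0 * fine (nu A) <= fine (Q y A) / fine (Q y setT)}.
Hypothesis Q_gt0 : {ae L, forall y, (0 < Q y setT)%E}.
Hypothesis Q_null : forall A, measurable A -> L A = 0%E ->
  {ae L, forall y, Q y A = 0%E}.
Hypothesis mh : measurable_fun setT h.
Hypothesis h_ge0 : forall x, 0 <= h x.
Hypothesis h_leH : forall x, h x <= H.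
Hypothesis kappa_gt0 : 0 < kappa.
Hypothesis h_eigen : {ae L, forall y, (\int[Q y]_x h x = kappa * h y)%R}.
Hypothesis nuh_gt0 : (0 < \int[nu]_x h x)%R.

Let properL : ProperFilter (almost_everywhere L).
Proof. exact: ae_properfilter_algebraOfSetsType. Qed.

Let Qfin y A : measurable A -> Q y A \is a fin_num.
Proof. by move=> mA; rewrite ge0_fin_numE// spker_lty. Qed.

(** As [L] is not zero, properties that hold almost everywhere hold together at some point [y].
    There [Q y A] vanishes, and the minorization forces [nu A] to vanish too. *)
Lemma nu_null A : measurable A -> L A = 0%E -> nu A = 0%E.
Proof.
move=> mA LA.
have [y [mino [Q0 QA]]] := @filter_ex _ _ properL _
  (filterI minorization (filterI Q_gt0 (Q_null _ mA LA))).
apply/eqP; rewrite eq_le measure_ge0 andbT.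
have := mino A mA; rewrite QA mul0r pmulr_rle0//.
by rewrite -lee_fin fineK// fin_num_measure.
Qed.

Lemma ae_nu (P : set T) : {ae L, forall x, P x} -> {ae nu, forall x, P x}.
Proof. by case=> N [mN N0 PN]; exists N; split => //; exact: nu_null. Qed.

Lemma ae_Q (P : set T) : {ae L, forall x, P x} ->
  {ae L, forall y, {ae Q y, forall x, P x}}.
Proof.
by case=> N [mN N0 PN]; have := Q_null _ mN N0; apply: filterS => y QN; exists N.
Qed.

Lemma bounded_measurable_h : bounded_measurable h.
Proof. by split => //; exists H => x; rewrite ger0_norm. Qed.

Lemma H_gt0 : 0 < H.
Proof.
rewrite ltNge; apply/negP => H0.
suff h0 : h = cst 0 by move: nuh_gt0; rewrite h0 /= Rintegral_cst// mul0r ltxx.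
apply/funext => x /=; apply/eqP; rewrite eq_le h_ge0 andbT.
exact: le_trans (h_leH x) H0.
Qed.

(** The minorization on the whole space gives [c0 <= 1], while [h <= H] bounds the integral by [H].
    This orders the initial barriers and makes the contraction factor nonnegative. *)
Lemma c0nuh_leH : c0 * (\int[nu]_x h x)%R <= H.
Proof.
have [y [mino Q0]] := @filter_ex _ _ properL _ (filterI minorization Q_gt0).
have := mino setT measurableT.
rewrite probability_setT mulr1 divff => [c01|]; last first.
  by rewrite gt_eqF// fine_gt0// Q0 spker_lty.
have nuhH : (\int[nu]_x h x <= H)%R.
  have nufin : (nu setT < +oo)%E by rewrite probability_setT ltry.
  apply: (@le_trans _ _ (\int[nu]_(x in setT) H)%R).
    apply: le_Rintegral => //; apply: bounded_measurable_integrable => //.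
      exact: bounded_measurable_h.
    exact: bounded_measurable_cst.
  rewrite Rintegral_cst// [X in fine X](_ : _ = 1%E) ?mulr1//.
  exact: probability_setT.
by rewrite (le_trans _ nuhH)// ler_piMl// ltW.
Qed.

(** The minorization compares the measures [c0 Q1(y) nu] and [Q y] set by set, hence also their
    integrals of nonnegative functions. *)
Lemma minorization_integral g : bounded_measurable g ->
  {ae L, forall x, 0 <= g x} ->
  {ae L, forall y, (c0 * fine (Q y setT) * \int[nu]_x g x <= \int[Q y]_x g x)%R}.
Proof.
(* [g] may be negative on an [L]-null set. Its positive part is nonnegative everywhere and has the
   same integrals against [nu] and against [Q y] for almost every [y]. *)
move=> bg g0; pose gp x := Num.max (g x) 0.
have mg := bg.1.
have mgp : measurable_fun setT gp by exact: measurable_maxr.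
have gp0 x : 0 <= gp x by rewrite le_max lexx orbT.
have nugp : (\int[nu]_x g x = \int[nu]_x gp x)%R.
  congr fine; apply: ae_eq_integral => //; try exact/measurable_EFinP.
  by have := ae_nu _ g0; apply: filterS => x gx _ /=; rewrite /gp max_l.
move: (ae_Q _ g0) Q_gt0 minorization; apply: filterS3 => y Qg0 Qy mino.
have Qgp : (\int[Q y]_x g x = \int[Q y]_x gp x)%R.
  congr fine; apply: ae_eq_integral => //; try exact/measurable_EFinP.
  by move: Qg0; apply: filterS => x gx _ /=; rewrite /gp max_l.
have q0 : 0 < fine (Q y setT) by rewrite fine_gt0// Qy spker_lty.
have r0 : 0 <= c0 * fine (Q y setT) by rewrite mulr_ge0// ltW.
rewrite nugp Qgp.
have bgp : bounded_measurable gp.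
  split => //; have [M gM] := bg.2; exists M => x.
  rewrite ger0_norm// /gp ge_max (le_trans (ler_norm _) (gM x))/=.
  exact: le_trans (normr_ge0 _) (gM x).
have nufin : (nu setT < +oo)%E by rewrite probability_setT ltry.
have i1 := bounded_measurable_integrable _ _ nufin bgp.
have i2 := bounded_measurable_integrable _ _ (spker_lty Q y _ measurableT) bgp.
have mEgp : measurable_fun setT (EFin \o gp) by exact/measurable_EFinP.
have le_int : ((c0 * fine (Q y setT))%:E * \int[nu]_x (gp x)%:E <=
    \int[Q y]_x (gp x)%:E)%E.
  rewrite -[(c0 * _)%R]/((NngNum r0)%:num) -ge0_integral_mscale//; last first.
    by move=> x _; rewrite lee_fin.
  apply: ge0_le_measure_integral => // S mS.
  apply: (@le_trans _ _ ((c0 * fine (Q y setT))%:E * (fine (nu S))%:E)%E).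
    by rewrite fineK ?fin_num_measure.
  rewrite -[leRHS]fineK ?Qfin//.
  by rewrite -EFinM lee_fin mulrAC -ler_pdivlMr// mino.
have fnu : (\int[nu]_x (gp x)%:E)%E \is a fin_num by exact: integrable_fin_num.
have fQ : (\int[Q y]_x (gp x)%:E)%E \is a fin_num by exact: integrable_fin_num.
by rewrite -lee_fin EFinM /Rintegral !fineK.
Qed.

Variable u : nat -> T -> R.
Hypothesis bm_u : forall n, bounded_measurable (u n).
Hypothesis u0 : forall x, u 0%N x = 1.
Hypothesis uS : forall n y, (u n.+1 y = kappa^-1 * \int[Q y]_x u n x)%R.

Let c := c0 / H.
Let nuh := (\int[nu]_x h x)%R.
Let nuu n := (\int[nu]_x u n x)%R.

Let c_gt0 : 0 < c. Proof. by rewrite divr_gt0// H_gt0. Qed.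

Let nufin : (nu setT < +oo)%E. Proof. by rewrite probability_setT ltry. Qed.

(** [kappa h = Q h <= H Q1] almost everywhere: this bounds the mass in the minorization below by a
    multiple of [h]. *)
Let Qh_le : {ae L, forall y, kappa * h y <= fine (Q y setT) * H}.
Proof.
move: h_eigen; apply: filterS => y <-.
apply: (@le_trans _ _ (\int[Q y]_(x in setT) H)%R).
  apply: le_Rintegral => //; apply: bounded_measurable_integrable => //.
  - exact: spker_lty.
  - exact: bounded_measurable_h.
  - exact: spker_lty.
  - exact: bounded_measurable_cst.
by rewrite Rintegral_cst// mulrC.
Qed.

(** The free signs [s] and [t] cover both [u - m h] and [M h - u]. For [g = s u + t h] the
    minorization and [Qh_le] give [Q g >= kappa c nu(g) h]; dividing by [kappa] turns [s u n] into
    [s u n.+1] and leaves [t h] fixed, because [h] is an eigenfunction. *)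
Lemma doeblin_step n (s t : R) :
  {ae L, forall x, 0 <= s * u n x + t * h x} ->
  0 <= s * nuu n + t * nuh /\
  {ae L, forall x, c * (s * nuu n + t * nuh) * h x <= s * u n.+1 x + t * h x}.
Proof.
move=> g0; pose g x := s * u n x + t * h x.
have bg : bounded_measurable g by apply: bounded_measurable_lin; last exact: bounded_measurable_h.
have nug : (\int[nu]_x g x)%R = s * nuu n + t * nuh.
  by rewrite Rintegral_lin//; exact: bounded_measurable_h.
have nug0 : 0 <= s * nuu n + t * nuh.
  by rewrite -nug; apply: ae_Rintegral_ge0 => //; exact: ae_nu.
split => //.
move: (minorization_integral _ bg g0) Qh_le h_eigen; apply: filterS3 => y.
rewrite nug Rintegral_lin//; [|exact: spker_lty|exact: bounded_measurable_h].
move=> le1 le2 Eh; rewrite Eh in le1.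
rewrite uS -(ler_pM2l kappa_gt0).
rewrite [leRHS](_ : _ = s * (\int[Q y]_x u n x)%R + t * (kappa * h y)); last first.
  by field; rewrite gt_eqF.
apply: le_trans le1.
rewrite [leLHS](_ : _ = c0 * (kappa * h y / H) * (s * nuu n + t * nuh)); last first.
  by rewrite /c; field; rewrite gt_eqF// H_gt0.
by rewrite ler_wpM2r// ler_pM2l// ler_pdivrMr// H_gt0.
Qed.

Let Phi n z := z + c * (nuu n - z * nuh).

(* Lower and upper barriers for [u n / h] evolve by the same affine map, of
   slope [1 - c * nuh], so that their gap shrinks geometrically. *)
Let Fixpoint barrier (z : R) (n : nat) : R :=
  if n is k.+1 then Phi n (barrier z k) else z.

(** The barriers start at [u 1 = Q1 / kappa], which explains the index shift below: [Qh_le] yields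
    [h / H <= u 1], and the minorization applied to [h] yields [u 1 <= h / (c0 nuh)]. *)
Let m0 := H^-1.
Let M0 := (c0 * nuh)^-1.

(** Each step adds [c] times the [nu]-integral of a function that is nonnegative almost everywhere,
    so the barrier never drops below [m0]. This makes it safe to divide by it later. *)
Let lower_barrier n :
  m0 <= barrier m0 n /\ {ae L, forall x, barrier m0 n * h x <= u n.+1 x}.
Proof.
elim: n => [|n [m0n IH]].
  split => //=; move: Qh_le; apply: filterS => y qh.
  rewrite uS; under eq_Rintegral do rewrite u0.
  rewrite Rintegral_cst// mul1r ler_pdivlMl// mulrCA.
  by rewrite ler_pdivrMl ?H_gt0// [leRHS]mulrC.
have [|Phi_ge ae_le] := doeblin_step n.+1 1 (- barrier m0 n).
  by move: IH; apply: filterS => x; rewrite mul1r mulNr subr_ge0.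
rewrite !mul1r mulNr in Phi_ge ae_le.
split=> /=.
  by rewrite (le_trans m0n)// lerDl mulr_ge0// ltW.
move: ae_le; apply: filterS => x; rewrite mul1r mulNr.
by rewrite /Phi; lra.
Qed.

Let upper_barrier n : {ae L, forall x, u n.+1 x <= barrier M0 n * h x}.
Proof.
elim: n => [|n IH].
  have := minorization_integral _ bounded_measurable_h (aeW _ h_ge0).
  move: h_eigen; apply: filterS2 => y -> le1 /=.
  rewrite uS; under eq_Rintegral do rewrite u0.
  rewrite Rintegral_cst// mul1r ler_pdivrMl// mulrCA ler_pdivlMl ?mulr_gt0//.
  by rewrite mulrAC.
have [|_] := doeblin_step n.+1 (-1) (barrier M0 n).
  by move: IH; apply: filterS => x; rewrite mulN1r addrC subr_ge0.
by apply: filterS => x; rewrite /= /Phi; lra.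
Qed.

Let barrier_gap n :
  barrier M0 n - barrier m0 n = (M0 - m0) * (1 - c * nuh) ^+ n.
Proof.
elim: n => [|n IH] /=; first by rewrite expr0 mulr1.
by rewrite /Phi exprS mulrCA -IH; ring.
Qed.

Lemma eigenfunction_approx e : 0 < e -> exists b n,
  0 < b /\ {ae L, forall x, `|b * u n x - h x| <= e}.
Proof.
move=> e0.
have H0 := H_gt0.
have m00 : 0 < m0 by rewrite invr_gt0.
have cnuh0 : 0 < c * nuh by rewrite mulr_gt0.
have cnuh1 : c * nuh <= 1.
  by rewrite /c mulrAC ler_pdivrMr// mul1r c0nuh_leH.
have C0 : 0 <= M0 - m0.
  by rewrite subr_ge0 lef_pV2 ?c0nuh_leH// posrE mulr_gt0.
have r01 : `|1 - c * nuh| < 1.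
  by rewrite ger0_norm; [rewrite ltrBlDr ltrDl|rewrite subr_ge0].
have cvg_gap : (M0 - m0) * H / m0 * (1 - c * nuh) ^+ n @[n --> \oo] --> (0 : R).
  rewrite -[X in _ --> X](mulr0 ((M0 - m0) * H / m0)).
  by apply: cvgMr; exact: cvg_expr.
(* The error will be at most the gap times [H], divided by the lower barrier, and that barrier is at
   least [m0]. *)
have [n _ /(_ n (leqnn n)) gap_n] : \forall n \near \oo,
    (M0 - m0) * H / m0 * (1 - c * nuh) ^+ n <= e.
  by apply: (cvgr_le (0 : R)).
have [m0n low] := lower_barrier n.
have mn0 := lt_le_trans m00 m0n.
(* Dividing by the lower barrier places the rescaled [u n.+1] above [h], so only an upper estimate
   of the difference remains. *)
exists (barrier m0 n)^-1, n.+1; split; first by rewrite invr_gt0.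
move: low (upper_barrier n); apply: filterS2 => x lx ux.
rewrite ger0_norm; last by rewrite subr_ge0 mulrC ler_pdivlMr// mulrC.
rewrite lerBlDr ler_pdivrMl//.
apply: (le_trans ux).
have -> : barrier M0 n = barrier m0 n + (M0 - m0) * (1 - c * nuh) ^+ n.
  by rewrite -barrier_gap addrC subrK.
rewrite mulrDl mulrDr addrC lerD2r.
have r0 : 0 <= (1 - c * nuh) ^+ n by rewrite exprn_ge0// subr_ge0.
apply: (@le_trans _ _ (m0 * e)); last by rewrite ler_wpM2r// ltW.
apply: (@le_trans _ _ (m0 * ((M0 - m0) * H / m0 * (1 - c * nuh) ^+ n))).
  rewrite [leRHS](_ : _ = (M0 - m0) * (1 - c * nuh) ^+ n * H); last first.
    by field; rewrite gt_eqF.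
  by rewrite ler_wpM2l// mulr_ge0.
by rewrite ler_pM2l.
Qed.

End doeblin.

(** * Null sets, signs of densities and positivity of [nu(h)] *)

Lemma ge0_integral_eq0_ae {d} {T : measurableType d} {R : realType}
    (mu : {measure set T -> \bar R}) (f : T -> \bar R) (D : set T) :
  measurable D -> measurable_fun D f -> (forall x, D x -> (0 <= f x)%E) ->
  (\int[mu]_(x in D) f x = 0)%E -> {ae mu, forall x, D x -> f x = 0%E}.
Proof.
move=> mD mf f0 if0; have : (\int[mu]_(x in D) `|f x| = 0)%E.
  by rewrite -[RHS]if0; apply: eq_integral => x /set_mem Dx; rewrite gee0_abs ?f0.
by move/(ae_eq_integral_abs _ mD mf).
Qed.

(** On the set where [f < 0], the integral of [f] is the measure of that set, hence nonnegative. So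
    [-f] integrates to zero there and must vanish almost everywhere on it. *)
Lemma density_ae_ge0 {d} {T : measurableType d} {R : realType}
    (L : {measure set T -> \bar R}) (nu : {measure set T -> \bar R}) (f : T -> R) :
  measurable_fun setT f ->
  (forall A, measurable A -> nu A = (\int[L]_(x in A) (f x)%:E)%E) ->
  {ae L, forall x, 0 <= f x}.
Proof.
move=> mf nuf; pose A := [set x | f x < 0].
have mA : measurable A.
  by rewrite -[A]setTI; exact: (measurable_fun_ltr (f := f) (g := cst 0)).
have mfA : measurable_fun A (fun x => (- f x)%:E).
  by apply/measurable_EFinP; apply: measurable_funTS; exact: measurableT_comp.
have nfA x : A x -> (0 <= (- f x)%:E)%E by rewrite lee_fin oppr_ge0 => /ltW.
have i0 : (\int[L]_(x in A) (- f x)%:E = 0)%E.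
  apply/eqP; rewrite eq_le integral_ge0// andbT.
  have := measure_ge0 nu A; rewrite [leRHS]nuf//.
  rewrite (eq_integral (fun x => - (- f x)%:E)%E); last first.
    by move=> x _; rewrite -EFinN opprK.
  by rewrite integral_ge0N// oppe_ge0.
have := ge0_integral_eq0_ae _ _ _ mA mfA nfA i0.
apply: filterS => x fA; rewrite leNgt; apply/negP => fx0.
by have [/eqP] := fA fx0; rewrite oppr_eq0 lt_eqF.
Qed.

Lemma eq_integral_density {d} {T : measurableType d} {R : realType}
    (L : {measure set T -> \bar R}) (f g : T -> R) :
  measurable_fun setT f -> measurable_fun setT g ->
  {ae L, forall x, f x = g x} ->
  forall A, measurable A ->
    (\int[L]_(x in A) (f x)%:E = \int[L]_(x in A) (g x)%:E)%E.
Proof.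
move=> mf mg fg A mA; apply: ae_eq_integral => //.
- by apply/measurable_EFinP; exact: measurable_funTS.
- by apply/measurable_EFinP; exact: measurable_funTS.
- by move: fg; apply: filterS => x ->.
Qed.

(** Duality on [A] times the whole space has left side zero when [L A = 0], so the integral of
    [a psi Q(., A)] is zero, and [a psi] is positive. *)
Lemma duality_null {d} {T : measurableType d} {R : realType}
    (L : {measure set T -> \bar R}) (P Q : R.-spker T ~> T) (psi : T -> R) (a : R) :
  measurable_fun setT psi -> (forall x, 0 < psi x) -> 0 < a ->
  (forall C : set (T * T), measurable C ->
    \int[L]_x ((psi x)%:E * \int[P x]_y (\1_C (x, y))%:E)
    = a%:E * \int[L]_y ((psi y)%:E * \int[Q y]_x (\1_C (x, y))%:E))%E ->
  forall A, measurable A -> L A = 0%E -> {ae L, forall y, Q y A = 0%E}.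
Proof.
move=> mpsi psi0 a0 dual A mA LA.
have := duality_rectangle L P Q psi a mpsi psi0 a0 dual A setT mA measurableT.
rewrite (_ : integral L setT _ = 0)%E; last first.
  rewrite (ae_eq_integral (cst 0%E))// ?integral0//.
  - apply: emeasurable_funM; last exact: measurable_fun_dirac.
    by apply: emeasurable_funM; [exact/measurable_EFinP|exact: measurable_kernel].
  - exists A; split => // x /=; apply: contra_notP => nA _.
    by rewrite diracE memNset// mule0.
move/esym => i0.
pose g y := ((a * psi y * \1_[set: T] y)%:E * Q y A)%E.
have mg : measurable_fun setT g.
  apply: emeasurable_funM; last exact: measurable_kernel.
  by apply/measurable_EFinP; do ! apply: measurable_funM.
have g0 y : setT y -> (0 <= g y)%E.
  by move=> _; rewrite mule_ge0// lee_fin !mulr_ge0// ltW.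
have := ge0_integral_eq0_ae L g setT measurableT mg g0 i0.
apply: filterS => y /(_ I)/eqP.
by rewrite /g indicT mulr1 mule_eq0 eqe gt_eqF ?mulr_gt0//= => /eqP.
Qed.

(** If [nu(h) = 0], then at [nu]-almost every [y] both [h y] and [Q h (y) = k h y] vanish, so
    [h = 0] almost everywhere for [Q y]. But [h] vanishes on [O] only within an [L]-null set, which
    [Q y] does not charge. Hence [Q y O = 0] for [nu]-almost every [y], a contradiction. *)
Lemma eigenfunction_integral_gt0 {d} {T : measurableType d} {R : realType}
    (L : {measure set T -> \bar R}) (nu : probability T R) (Q : R.-spker T ~> T)
    (h : T -> R) (k : R) (O : set T) :
  (forall A, measurable A -> L A = 0%E -> nu A = 0%E) ->
  (forall A, measurable A -> L A = 0%E -> {ae L, forall y, Q y A = 0%E}) ->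
  bounded_measurable h -> (forall x, 0 <= h x) ->
  {ae L, forall y, (\int[Q y]_x (h x)%:E = (k * h y)%:E)%E} ->
  measurable O -> L (O `&` [set x | h x = 0]) = 0%E ->
  (0 < \int[nu]_y Q y O)%E -> (0 < \int[nu]_x h x)%R.
Proof.
move=> nu_L Q_L bh h0 eig mO LO nuQO; have [mh _] := bh.
have ae_nu (P : set T) : {ae L, forall x, P x} -> {ae nu, forall x, P x}.
  by case=> N [mN N0 PN]; exists N; split => //; exact: nu_L.
have mZ : measurable (O `&` [set x | h x = 0]).
  apply: measurableI => //; rewrite -[X in measurable X]setTI.
  exact: (mh measurableT [set 0] (measurable_set1 0)).
rewrite lt_neqAle Rintegral_ge0// andbT eq_sym; apply/eqP => nuh0.
have nufin : (nu setT < +oo)%E by rewrite probability_setT ltry.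
have inuh0 : (\int[nu]_x (h x)%:E = 0)%E.
  rewrite -[LHS]fineK; first by move: nuh0; rewrite /Rintegral => ->.
  by apply: integrable_fin_num => //; exact: bounded_measurable_integrable.
have mEh : measurable_fun setT (EFin \o h) by exact/measurable_EFinP.
have hnu : {ae nu, forall x, setT x -> (h x)%:E = 0%E}.
  by apply: ge0_integral_eq0_ae => // x _; rewrite lee_fin.
move: nuQO; rewrite (ae_eq_integral (cst 0%E))// ?integral0 ?ltxx//.
  exact: measurable_kernel.
move: hnu (ae_nu _ eig) (ae_nu _ (Q_L _ mZ LO)).
apply: filterS3 => y /(_ I)[hy] Qh QZ _ /=.
have hQ : {ae Q y, forall x, setT x -> (h x)%:E = 0%E}.
  apply: ge0_integral_eq0_ae => //; first by move=> x _; rewrite lee_fin.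
  by rewrite Qh EFinM hy mule0.
apply: measure_negligible => //.
have nZ : (Q y).-negligible (O `&` [set x | h x = 0]) by exact/negligibleP.
apply: negligibleS (negligibleU nZ hQ) => x Ox /=.
have [hx|hx] := pselect (h x = 0); [by left|right].
by move=> /(_ I)[].
Qed.

(** * Borel sets, lower semicontinuity and quasi-stationarity *)

Section borel.
Context {R : realType} {T : pseudoPMetricType R}.
Local Notation B := (Borel T).

Lemma open_measurable_borel (U : set T) : open U -> measurable (U : set B).
Proof. by move=> oU; exact: sub_sigma_algebra. Qed.

Lemma lsc_open (g : T -> R) : lsc g <-> forall a, open [set x | a < g x].
Proof.
split=> [/lower_semicontinuousP gl a|go].
  by have := gl a; under eq_set do rewrite lte_fin.
by apply/lower_semicontinuousP => a; under eq_set do rewrite lte_fin.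
Qed.

Lemma lsc_measurable (g : T -> R) : lsc g -> measurable_fun [set: B] (g : B -> R).
Proof.
move=> /lsc_open go; apply: (measurability _ (RGenOInfty.measurableE R)).
move=> /= _ [_ [a ->]] <-; rewrite setTI; apply: open_measurable_borel.
by rewrite preimage_itvoy; exact: go.
Qed.

Lemma continuous_lsc (g : T -> R) : continuous g -> lsc g.
Proof.
move=> cg; apply/lsc_open => a.
by apply: (open_comp (D := [set r | a < r])) => // x _; exact: cg.
Qed.

(* [filterS] and [filterS2] for predicates on [T] rather than on its alias
   [Borel T]: there the filter instance of [almost_everywhere] is not found. *)
Lemma ae_borelS (L : {measure set B -> \bar R}) (P Q : set T) :
  (forall x, P x -> Q x) -> {ae L, forall x, P x} -> {ae L, forall x, Q x}.
Proof. exact: (@filterS _ _ (ae_filter_ringOfSetsType L)). Qed.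

Lemma ae_borelS2 (L : {measure set B -> \bar R}) (P P' Q : set T) :
  (forall x, P x -> P' x -> Q x) ->
  {ae L, forall x, P x} -> {ae L, forall x, P' x} -> {ae L, forall x, Q x}.
Proof. exact: (@filterS2 _ _ (ae_filter_ringOfSetsType L)). Qed.

Lemma full_support_open (L : {measure set B -> \bar R}) (U : set T) :
  full_support L -> open U -> L U = 0%E -> U = set0.
Proof.
move=> Lfull oU U0; have [//|/set0P/(Lfull _ oU)] := eqVneq U set0.
by rewrite U0 ltxx.
Qed.

(** The factor is the survival probability of [pi] up to time [t]. It is positive and at most one,
    so the quotient of [fine] values in [is_QSD] can be cleared. *)
Lemma quasi_stationary_exit (P : R -> R.-spker B ~> B) (pi : probability B R) t :
  is_QSD P pi -> 0 <= t -> exists2 lambda : R, 0 < lambda &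
    forall A, measurable A -> (\int[pi]_x P t x A = lambda%:E * pi A)%E.
Proof.
move=> qsd t0; have [mass stat] := qsd t t0.
have mPfin A : measurable A -> mP pi (P t) A \is a fin_num.
  move=> mA; rewrite ge0_fin_numE ?integral_ge0//.
  apply: (@le_lt_trans _ _ (\int[pi]_x cst 1 x)%E).
    apply: ge0_le_integral => //; first exact: measurable_kernel.
    by move=> x _; rewrite (le_trans _ (sprob_kernel_le1 (P t) x))// le_measure// inE.
  by rewrite integral_cst// mul1e [X in (X < _)%E](_ : _ = 1%E) ?ltry//; exact: probability_setT.
have l0 : 0 < fine (mP pi (P t) setT).
  by rewrite fine_gt0// mass -ge0_fin_numE ?mPfin ?integral_ge0.
exists (fine (mP pi (P t) setT)) => // A mA.
transitivity (fine (mP pi (P t) A))%:E; first by rewrite fineK// mPfin.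
rewrite -[pi A]fineK ?fin_num_measure// -EFinM -stat//.
by rewrite mulrC divfK// gt_eqF.
Qed.

End borel.

(** * Uniform approximation of the density *)

Section density_approximation.
Context {R : realType} {T : pseudoPMetricType R}.
Local Notation B := (Borel T).
Implicit Types (L : {measure set B -> \bar R}) (pi : probability B R).

Lemma density_version_ae L pi (f g : T -> R) :
  density_version L pi f -> measurable_fun [set: B] (g : B -> R) ->
  {ae L, forall x, f x = g x} -> density_version L pi g.
Proof.
move=> [mf pif] mg fg; split => // A mA; rewrite pif//.
exact: eq_integral_density fg _ mA.
Qed.

Lemma bounded_density_version L pi : in_P_infty L pi ->
  exists f : T -> R, density_version L pi f /\ exists F, forall x, 0 <= f x <= F.
Proof.
move=> [f [[mf pif] [M fM]]].
(* Clamping [f] between [0] and [M] changes it only on a null set and makes the bounds hold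
   everywhere. *)
exists (fun x => Num.max 0 (Num.min (f x) M)); split.
  apply: (density_version_ae _ _ f) => //.
    by apply: measurable_maxr => //; exact: measurable_minr.
  move: (density_ae_ge0 _ _ _ mf pif) fM; apply: filterS2 => x f0 fM.
  rewrite min_l; last exact: le_trans (ler_norm _) fM.
  by rewrite max_r.
exists `|M| => x; rewrite le_max lexx/= ge_max normr_ge0/=.
by rewrite ge_min (ler_norm M) orbT.
Qed.

Lemma kact_cst1 (k : B -> {measure set B -> \bar R}) y :
  kact k (fun _ => 1) y = fine (k y setT).
Proof. by rewrite /kact integral_cst// mul1e. Qed.

(** This is the only consequence of quasi-stationarity and Assumption (C) used afterwards:
    regularity of the masses [Pt s 1] can then be transferred to the density. *)
Lemma density_approximation L (P Pt : R -> R.-spker B ~> B) pi :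
  submarkov_semigroup Pt -> is_QSD P pi -> in_P_infty L pi ->
  assumption_C L P Pt pi ->
  exists f psi : T -> R,
    [/\ density_version L pi f, exists F, forall x, 0 <= f x <= F,
        bounded_continuous psi, forall x, 0 < psi x &
        forall e, 0 < e -> exists alpha s, [/\ 0 < alpha, 0 <= s &
          {ae L, forall x,
            `|alpha * psi x * kact (Pt s) (fun _ => 1) x - f x| <= e}]].
Proof.
move=> [Pt0 PtD] qsd /bounded_density_version[f [[mf pif] [F fF]]].
move=> [[psi [a [[bcpsi [cpsi [cpsi0 cpsi_le]]] [a0 dual]]]] [Pt_gt0 ergo]].
have [c0 [t0 [nu [c00 [t00 [mino [U [c1 [t1 [oU [c10 [t10 [piU nuU]]]]]]]]]]]]] := ergo.
have psi0 x : 0 < psi x by exact: lt_le_trans (cpsi_le x).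
exists f, psi; split => //; first by exists F.
have [cpsi_c [Psi psi_le]] := bcpsi.
have mpsi : measurable_fun [set: B] (psi : B -> R).
  exact: lsc_measurable _ (continuous_lsc _ cpsi_c).
have mU : measurable (U : set B) by exact: open_measurable_borel.
pose h x := f x / psi x.
have h0 x : 0 <= h x by rewrite divr_ge0 ?(ltW (psi0 x))//; case/andP: (fF x).
have mh : measurable_fun [set: B] (h : B -> R).
  have cpsiV : continuous (fun x => (psi x)^-1).
    by move=> x; apply: cvgV; [rewrite gt_eqF|exact: cpsi_c].
  by apply: measurable_funM => //; exact: lsc_measurable _ (continuous_lsc _ cpsiV).
have fh x : f x = psi x * h x by rewrite mulrC divfK// gt_eqF.
have F0 : 0 <= F by case/andP: (fF point); exact: le_trans.
pose H := F / cpsi.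
have hH x : h x <= H.
  case/andP: (fF x) => ? fxF.
  apply: ler_pM => //; first by rewrite invr_ge0 ltW.
  by rewrite lef_pV2 ?posrE.
have f0 x : 0 <= f x by case/andP: (fF x).
have LT : (0 < L setT)%E.
  rewrite lt0e measure_ge0 andbT; apply/eqP => L0.
  have : pi setT = 0%E.
    rewrite pif// (ae_eq_integral (cst 0%E))// ?integral0//; first exact/measurable_EFinP.
    by exists setT.
  by rewrite probability_setT => -[] /eqP; rewrite oner_eq0.
(* The same [h] is an eigenfunction at every time: [t1] is needed for [nu(h) > 0], and [t0] for the
   iteration. *)
have eig t : 0 <= t -> exists2 kappa : R, 0 < kappa &
    {ae L, forall y, (\int[Pt t y]_x (h x)%:E = (kappa * h y)%:E)%E}.
  move=> t_ge0; have [lambda l0 stat] := quasi_stationary_exit P pi t qsd t_ge0.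
  exists (lambda / a `^ t); first by rewrite divr_gt0// powR_gt0.
  apply: (dual_eigenfunction L pi f mf f0 pif (P t) (Pt t) psi) => //.
  - exact: powR_gt0.
  - exact: dual.
have null t : 0 <= t -> forall A, measurable A -> L A = 0%E ->
    {ae L, forall y, Pt t y A = 0%E}.
  move=> t_ge0; apply: (duality_null L (P t) (Pt t) psi (a `^ t)) => //.
  - exact: powR_gt0.
  - exact: dual.
have nuL : forall A, measurable A -> L A = 0%E -> nu A = 0%E.
  exact: (nu_null L (Pt t0) nu c0 LT c00 mino (Pt_gt0 _ t00) (null _ (ltW t00))).
have nuh : (0 < \int[nu]_x h x)%R.
  have [k1 k10 eig1] := eig t1 (ltW t10).
  apply: (eigenfunction_integral_gt0 L nu (Pt t1) h k1 U nuL (null _ (ltW t10))) => //.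
    by split => //; exists H => x; rewrite ger0_norm.
  pose Z : set B := [set x | h x = 0].
  have mZ : measurable Z.
    rewrite -[Z]setTI; exact: (mh measurableT [set 0] (measurable_set1 0)).
  (* [f] vanishes on [Z], so [pi Z = 0], and the lower bound for [pi] on [U] makes the part of [Z]
     inside [U] null. *)
  have : (c1%:E * L (Z `&` U) <= 0)%E.
    rewrite (le_trans (piU _ mZ))// pif// (eq_integral (cst 0%E)) ?integral0//.
    by move=> x /set_mem hx; rewrite fh hx mulr0.
  by rewrite pmule_rle0 ?lte_fin// measure_le0 setIC => /eqP.
have [kappa kappa0 eig0] := eig t0 (ltW t00).
(* By the semigroup property the [n]-th iterate of [Pt t0] on [1] is the mass at time [n t0]. *)
pose u n x := kappa ^- n * fine (Pt (n%:R * t0) x setT).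
have n0 n : 0 <= n%:R * t0 by rewrite mulr_ge0// ltW.
have eigR : {ae L, forall y, (\int[Pt t0 y]_x h x = kappa * h y)%R}.
  by move: eig0; apply: filterS => y; rewrite /Rintegral => ->.
have bm_fine n : bounded_measurable (fun x : B => fine (Pt (n%:R * t0) x setT)).
  split.
    apply: (measurableT_comp (f := fine)) => //; exact: measurable_kernel.
  exists 1 => x; rewrite ger0_norm ?fine_ge0// -lee_fin fineK ?sprob_kernel_le1//.
  by rewrite ge0_fin_numE// spker_lty.
have bm_u n : bounded_measurable (u n : B -> R).
  have := bounded_measurable_lin _ _ (kappa ^- n) 0 (bm_fine n) (bm_fine n).
  by under eq_fun do rewrite mul0r addr0.
have u0 x : u 0%N x = 1.
  by rewrite /u expr0 invr1 mul1r mul0r Pt0// diracE in_setT.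
have uS n y : (u n.+1 y = kappa^-1 * \int[Pt t0 y]_x u n x)%R.
  rewrite /u RintegralZl//; last first.
    by apply: bounded_measurable_integrable; [exact: spker_lty|exact: bm_fine].
  rewrite exprS invfM -mulrA; congr (_ * (_ * _)).
  rewrite -natr1 mulrDl mul1r addrC PtD// ?(ltW t00)//; congr fine.
  apply: eq_integral => x _; rewrite fineK// ge0_fin_numE// spker_lty//.
move=> e e0.
have Psi0 : 0 < Psi by rewrite (lt_le_trans (psi0 point))// (le_trans (ler_norm _))// psi_le.
(* The tolerance is [e / Psi] because passing from [h] to [f] multiplies the error by
   [psi <= Psi]. *)
have [|b [n [b0 approx]]] := eigenfunction_approx L (Pt t0) nu c0 H kappa h LT c00 mino
  (Pt_gt0 _ t00) (null _ (ltW t00)) mh h0 hH kappa0 eigR nuh u bm_u u0 uS (e / Psi).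
  by rewrite divr_gt0.
exists (b * kappa ^- n), (n%:R * t0); split => //.
  by rewrite mulr_gt0// invr_gt0 exprn_gt0.
move: approx; apply: filterS => x; rewrite kact_cst1 /u fh => le_e.
rewrite (_ : _ - _ = psi x * (b * (kappa ^- n * fine (Pt (n%:R * t0) x setT)) - h x)); last by ring.
rewrite normrM (le_trans (ler_pM _ _ (psi_le x I) le_e))//.
by rewrite mulrC divfK// gt_eqF.
Qed.

End density_approximation.

(** * Continuous versions on an open set *)

Section continuous_version.
Context {R : realType} {T : pseudoPMetricType R}.
Local Notation B := (Borel T).
Variables (L : {measure set B -> \bar R}) (V : set T).
Hypotheses (Lfull : full_support L) (oV : open V).

(** The part of [V] where [g > e] is open and null, hence empty by full support. *)
Lemma ae_le_open (g : T -> R) (e : R) : {in V, continuous g} ->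
  {ae L, forall x, V x -> g x <= e} -> forall x, V x -> g x <= e.
Proof.
move=> cg ge x Vx; rewrite leNgt; apply/negP => ltex.
pose U := V `&` [set x | e < g x].
have oU : open U.
  rewrite openE => y [Vy ey]; apply: filterI; first exact: open_nbhs_nbhs.
  by apply: (cvgr_gt _ (cg y (mem_set Vy))).
have LU : L U = 0%E.
  apply: (measure_negligible (open_measurable_borel _ oU)).
  by apply: negligibleS ge => y [Vy /= ey] /(_ Vy); rewrite leNgt ey.
by have : U x by []; rewrite (full_support_open _ _ Lfull oU LU).
Qed.

Variables (f : T -> R) (w : nat -> T -> R) (eps : nat -> R).
Hypothesis eps_small : forall e, 0 < e -> exists k, eps k < e.
Hypothesis mf : measurable_fun [set: B] (f : B -> R).
Hypothesis cw : forall k, {in V, continuous (w k)}.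
Hypothesis bw : bounded_on (w 0%N) V.
Hypothesis wf : forall k, {ae L, forall x, `|w k x - f x| <= eps k}.

Lemma uniform_limit_version : exists g : T -> R,
  [/\ measurable_fun [set: B] (g : B -> R), {ae L, forall x, f x = g x},
      {within V, continuous g} & bounded_on g V].
Proof.
have w_cauchy k l x : V x -> w l x - w k x <= eps k + eps l.
  move: x; apply: ae_le_open => [x Vx|].
    by apply: cvgB; apply: cw.
  by apply: ae_borelS2 (wf k) (wf l) => x; rewrite !ler_distl => /andP[? ?] /andP[? ?] _; lra.
(* The uniform limit is written as a supremum: each [w k - eps k] belongs to the family, and each
   [w k + eps k] bounds it above on [V], so the supremum is within [eps k] of [w k]. *)
pose S x := range (fun l => w l x - eps l).
have S_ub k x : V x -> ubound (S x) (w k x + eps k).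
  by move=> Vx _ [l _ <-]; have := w_cauchy k l x Vx; lra.
have S0 x : S x !=set0 by exists (w 0%N x - eps 0%N); exists 0%N.
(* Outside [V], [g] keeps the values of [f], so it stays measurable and only points of [V] matter
   for almost everywhere equality. *)
pose g x := if x \in V then sup (S x) else f x.
have gw k x : V x -> `|g x - w k x| <= eps k.
  move=> Vx; rewrite /g mem_set// ler_distl; apply/andP; split.
    apply: ub_le_sup; last by exists k.
    by exists (w k x + eps k); exact: S_ub.
  by apply: ge_sup => //; exact: S_ub.
have cg : {in V, continuous g}.
  move=> x /set_mem Vx; apply/cvgrPdist_lt => e e0.
  (* Two approximation errors and one oscillation of [w k], each below [e / 4]. *)
  have e40 : 0 < e / 4 by rewrite divr_gt0.
  have [k ke] := eps_small _ e40.
  have Vn : nbhs x V by exact: open_nbhs_nbhs.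
  near=> y; have Vy : V y by near: y.
  have : `|w k x - w k y| < e / 4.
    by near: y; exact: (cvgr_dist_lt _ _ (cw k x (mem_set Vx)) _ e40).
  move: (gw k x Vx) (gw k y Vy).
  by rewrite !ler_distl !ltr_distl => /andP[? ?] /andP[? ?] /andP[? ?]; lra.
exists g; split.
- apply: (measurability _ (RGenOInfty.measurableE R)).
  move=> /= _ [_ [a ->]] <-; rewrite setTI preimage_itvoy.
  rewrite (_ : [set x | _] = (V `&` [set x | a < g x]) `|` (~` V `&` [set x | a < f x])).
    apply: measurableU.
      apply: open_measurable_borel; rewrite openE => x [Vx ax].
      apply: filterI; first exact: open_nbhs_nbhs.
      by apply: (cvgr_gt _ (cg x (mem_set Vx))).
    apply: measurableI; first exact: measurableC (open_measurable_borel _ oV).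
    rewrite -[X in measurable X]setTI.
    by apply: (measurable_fun_ltr (f := cst a)).
  apply/seteqP; split => x /=; last first.
    by move=> [[]//|[nVx]]; rewrite /g memNset.
  by have [Vx|nVx] := pselect (V x); [left|rewrite /g memNset; [right|]].
- have := ae_foralln wf; apply: filterS => x wfx.
  have [Vx|nVx] := pselect (V x); last by rewrite /g memNset.
  apply/eqP; rewrite -subr_eq0 -normr_le0; apply/ler_addgt0Pl => e e0.
  have e20 : 0 < e / 2 by rewrite divr_gt0.
  have [k ke] := eps_small _ e20.
  move: (wfx k) (gw k x Vx) ke; rewrite addr0 !ler_distl.
  by move=> /andP[? ?] /andP[? ?] ?; apply/andP; split; lra.
- by rewrite continuous_open_subspace.
- have [M wM] := bw; exists (M + eps 0%N) => x Vx.
  rewrite -(subrK (w 0%N x) (g x)) addrC (le_trans (ler_normD _ _))// lerD ?wM//.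
  exact: gw.
Unshelve. all: by end_near. Qed.
End continuous_version.

(** * The largest lower semicontinuous minorant *)

Section lsc_regularization.
Context {R : realType} {T : pseudoPMetricType R}.
Local Notation B := (Borel T).

(** With [r < e / 2] and [d] within [r / 2] of [x], the ball of radius [r] around [d] stays within
    [3 r / 2 < e] of [x]. Interiors are taken because balls need not be open. *)
Lemma open_dense_ball (D U : set T) (x : T) : dense D -> open U -> U x ->
  exists d m, [/\ D d, (ball d m.+1%:R^-1)° x & (ball d m.+1%:R^-1)° `<=` U].
Proof.
move=> Ddense oU Ux.
have /nbhs_ballP[e /= e0 eU] : nbhs x U by exact: open_nbhs_nbhs.
have e20 : 0 < e / 2 by rewrite divr_gt0.
have [m _ /(_ m (leqnn m))/= me] := near_infty_natSinv_lt (PosNum e20).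
pose r : R := m.+1%:R^-1.
have r20 : 0 < r / 2 by rewrite divr_gt0// invr_gt0.
have [d [xd Dd]] : (ball x (r / 2))° `&` D !=set0.
  by apply: Ddense; [exists x; exact: nbhsx_ballx|exact: open_interior].
have {}xd : ball x (r / 2) d by exact: interior_subset xd.
exists d, m; split => //.
  apply/nbhs_ballP; exists (r / 2) => //= y xy.
  exact: ball_split (ball_sym xd) xy.
move=> y /interior_subset dy; apply: eU.
apply: (le_ball _ (ball_triangle xd dy)).
by rewrite -/r in me *; lra.
Qed.

Variables (L : {measure set B -> \bar R}) (f : T -> R) (F : R).
Hypothesis Lfull : full_support L.
Hypothesis f_bound : forall x, 0 <= f x <= F.

(* The largest nonnegative lower semicontinuous function that is at most [f]
   almost everywhere. *)
Definition lsc_regularization (x : T) : R :=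
  sup [set q : R | q = 0 \/ exists U : set T,
    [/\ open U, U x & {ae L, forall y, U y -> q <= f y}]].

Local Notation S x := [set q : R | q = 0 \/ exists U : set T,
    [/\ open U, U x & {ae L, forall y, U y -> q <= f y}]].

(** A witness [q > F] would hold on a nonempty open set that is null, against full support. *)
Let S_ub x : ubound (S x) F.
Proof.
have F0 : 0 <= F by case/andP: (f_bound x); exact: le_trans.
move=> q [->//|[U [oU Ux qf]]]; rewrite leNgt; apply/negP => Fq.
have LU : L U = 0%E.
  apply: (measure_negligible (open_measurable_borel _ oU)).
  apply: negligibleS qf => y Uy /= /(_ Uy) qfy.
  by case/andP: (f_bound y) => _ /(le_trans qfy); rewrite leNgt Fq.
by move: Ux; rewrite (full_support_open _ _ Lfull oU LU).
Qed.

Let S_ubound x : has_ubound (S x). Proof. by exists F; exact: S_ub. Qed.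

Lemma lsc_regularization_ge0 x : 0 <= lsc_regularization x.
Proof. by apply: ub_le_sup => //; left. Qed.

Lemma lsc_regularization_le x : lsc_regularization x <= F.
Proof. by apply: ge_sup; [exists 0; left|exact: S_ub]. Qed.

(** An open set that witnesses a value above [a] at [x] witnesses it at all of its points. *)
Lemma lsc_lsc_regularization : lsc lsc_regularization.
Proof.
apply/lsc_open => a; rewrite openE => x ax.
have [q [q0|[U [oU Ux qf]]] aq] : exists2 q, S x q & a < q.
  by apply: sup_gt => //; exists 0; left.
  by apply: filterS filterT => y _ /=; rewrite (lt_le_trans aq)// q0 lsc_regularization_ge0.
apply: filterS (open_nbhs_nbhs (conj oU Ux)) => y Uy /=.
by rewrite (lt_le_trans aq)//; apply: ub_le_sup => //; right; exists U.
Qed.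

(** If [l] exceeded the regularization at [x], the midpoint [q] of the two values, with the open set
    where [l > q], would be an admissible witness at [x]. *)
Lemma lsc_le_regularization (l : T -> R) : lsc l -> {ae L, forall x, l x <= f x} ->
  forall x, l x <= lsc_regularization x.
Proof.
move=> /lsc_open ol lf x; rewrite leNgt; apply/negP => lt_l.
pose q := (lsc_regularization x + l x) / 2.
have : q <= lsc_regularization x.
  apply: ub_le_sup => //; right; exists [set y | q < l y]; split => //.
    by rewrite /q /=; lra.
  apply: ae_borelS lf => y lfy qy; exact: le_trans (ltW qy) lfy.
by rewrite /q; lra.
Qed.

(** Each witness has its own null set, and there may be uncountably many. Separability reduces them
    to balls around a dense sequence with radii [1 / (m + 1)] and rational values, whose null sets
    have a null union. *)
Lemma lsc_regularization_ae_le : @separable R T ->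
  {ae L, forall x, lsc_regularization x <= f x}.
Proof.
move=> [D [/pcard_surjP[s sD] Ddense]].
pose U i m : set T := (ball (s i) m.+1%:R^-1)°.
(* [n] encodes a centre, a radius and a rational. If the almost everywhere premise fails, [Q n]
   holds vacuously. *)
pose Q n x := if unpickle n is Some (i, m, r) then
  {ae L, forall y, U i m y -> ratr r <= f y} -> U i m x -> ratr r <= f x
  else True.
have aeQ n : {ae L, forall x, Q n x}.
  rewrite /Q; case: (unpickle n) => [[[i m] r]|]; last exact: aeW.
  have [h|nh] := pselect {ae L, forall y, U i m y -> ratr r <= f y}.
    by apply: ae_borelS h => x.
  by apply: aeW => x /nh.
apply: ae_borelS (ae_foralln aeQ) => x Qx.
apply: ge_sup; first by exists 0; left.
move=> q [->|[W [oW Wx qf]]]; first by case/andP: (f_bound x).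
rewrite leNgt; apply/negP => /rat_in_itvoo[r]; rewrite in_itv/= => /andP[fr rq].
have [d [m [Dd dx dW]]] := open_dense_ball _ _ _ Ddense oW Wx.
have [i _ sid] := sD _ Dd; rewrite -sid in dx dW.
have := Qx (pickle (i, m, r)); rewrite /Q pickleK => /(_ _ dx).
rewrite leNgt fr => /(_ _)/negP; apply => //.
by apply: ae_borelS qf => y qfy /dW Wy; exact: le_trans (ltW rq) (qfy Wy).
Qed.

End lsc_regularization.

(** * From the approximation to the two versions of the density *)

Lemma continuous_approximation_version {R : realType} {T : pseudoPMetricType R}
    (L : {measure set Borel T -> \bar R}) (k : R -> R.-spker Borel T ~> Borel T)
    (f psi : T -> R) (V : set T) :
  full_support L -> open V -> measurable_fun [set: Borel T] (f : Borel T -> R) ->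
  bounded_continuous psi ->
  (forall e, 0 < e -> exists alpha s, [/\ 0 < alpha, 0 <= s &
    {ae L, forall x, `|alpha * psi x * kact (k s) (fun _ => 1) x - f x| <= e}]) ->
  (forall t, 0 <= t -> bounded_on (kact (k t) (fun _ => 1)) setT /\
    {within V, continuous (kact (k t) (fun _ => 1))}) ->
  exists g : T -> R,
    [/\ measurable_fun [set: Borel T] (g : Borel T -> R), {ae L, forall x, f x = g x},
      {within V, continuous g} & bounded_on g V].
Proof.
move=> Lfull oV mf [cpsi [Psi psi_le]] approx regular.
have /choice[w wP] : forall n, exists w : T -> R, [/\ {in V, continuous w},
    bounded_on w V & {ae L, forall x, `|w x - f x| <= n.+1%:R^-1}].
  move=> n; have [|alpha [s [alpha0 s0 le_e]]] := approx n.+1%:R^-1.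
    by rewrite invr_gt0.
  have [[M kM] ck] := regular s s0.
  exists (fun x => alpha * psi x * kact (k s) (fun _ => 1) x); split => //.
    rewrite continuous_open_subspace// in ck => x Vx.
    apply: cvgM; last exact: ck.
    by apply: cvgMr; exact: cpsi.
  exists (alpha * Psi * M) => x _.
  rewrite !normrM (gtr0_norm alpha0) ler_pM ?mulr_ge0//; first exact: ltW.
    by rewrite ler_pM2l// psi_le.
  exact: kM.
apply: (uniform_limit_version L V Lfull oV f w (fun n => n.+1%:R^-1)) => //.
- move=> e e0; have [n _ /(_ n (leqnn n))/= ne] := near_infty_natSinv_lt (PosNum e0).
  by exists n.
- by move=> n; case: (wP n).
- by case: (wP 0%N).
- by move=> n; case: (wP n).
Qed.

Lemma lsc_subr {R : realType} {T : pseudoPMetricType R} (g : T -> R) (e : R) :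
  lsc g -> lsc (fun x => g x - e).
Proof.
move=> /lsc_open og; apply/lsc_open => a.
by under eq_set do rewrite ltrBrDr; exact: og.
Qed.

Lemma lsc_mul {R : realType} {T : pseudoPMetricType R} (p g : T -> R) :
  continuous p -> (forall x, 0 < p x) -> lsc g -> (forall x, 0 <= g x) ->
  lsc (fun x => p x * g x).
Proof.
move=> cp p0 /lsc_open og g0; apply/lsc_open => a; rewrite openE => x /= ax.
have [a0|a0] := ltP a 0.
  apply: filterS filterT => y _ /=.
  by rewrite (lt_le_trans a0)// mulr_ge0// ltW.
have apg : a / p x < g x by rewrite ltr_pdivrMr// mulrC.
(* A level strictly between [a / p x] and [g x]: near [x] one has [g > b] and [p > a / b], so the
   product exceeds [a]. *)
pose b := (a / p x + g x) / 2.
have ap0 : 0 <= a / p x by rewrite divr_ge0// ltW.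
have b1 : a / p x < b by rewrite /b; lra.
have b2 : b < g x by rewrite /b; lra.
have b0 : 0 < b by exact: le_lt_trans b1.
have near_g : \forall y \near x, b < g y by exact: open_nbhs_nbhs (conj (og b) b2).
have near_p : \forall y \near x, a / b < p y.
  apply: (cvgr_gt _ (cp x)).
  by rewrite ltr_pdivrMr// mulrC -ltr_pdivrMr.
apply: filterS2 near_g near_p => y bg pb /=.
rewrite (@le_lt_trans _ _ (p y * b))//; last by rewrite ltr_pM2l.
by rewrite -ler_pdivrMr// ltW.
Qed.

Lemma density_unique {d} {T : measurableType d} {R : realType}
    (L : {measure set T -> \bar R}) (pi : probability T R) (f g : T -> R) :
  measurable_fun setT f -> measurable_fun setT g ->
  (forall A, measurable A -> pi A = (\int[L]_(x in A) (f x)%:E)%E) ->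
  (forall A, measurable A -> pi A = (\int[L]_(x in A) (g x)%:E)%E) ->
  {ae L, forall x, f x = g x}.
Proof.
move=> mf mg pif pig.
have f0 := density_ae_ge0 _ _ _ mf pif.
have mEf : measurable_fun setT (EFin \o f) by exact/measurable_EFinP.
have fint : L.-integrable setT (EFin \o f).
  apply/integrableP; split => //.
  rewrite (ae_eq_integral (EFin \o f))//.
  - by rewrite -pif// (le_lt_trans (probability_le1 _ _))// ltry.
  - exact: measurableT_comp.
  - by move: f0; apply: filterS => x fx _; rewrite /= ger0_norm.
have : ae_eq L setT (EFin \o f) (EFin \o g).
  apply: integral_ae_eq => //; first exact/measurable_EFinP.
  by move=> E _ mE; rewrite -pif// -pig.
by apply: filterS => x /(_ I)[].
Qed.

Theorem mainTheorem12 (R : realType) (T : pseudoPMetricType R)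
  (L : {measure set Borel T -> \bar R})
  (P Pt : R -> R.-spker Borel T ~> Borel T) (pi : probability (Borel T) R) :
  hausdorff_space T ->
  sigma_finite setT L -> full_support L ->
  submarkov_semigroup P -> submarkov_semigroup Pt ->
  is_QSD P pi -> in_P_infty L pi -> assumption_C L P Pt pi ->
  (* (1) *)
  (forall V : set T, open V ->
     (forall t, 0 <= t -> forall f : T -> R, bounded_continuous f ->
        measurable_fun [set: Borel T] (kact (Pt t) f : Borel T -> R) /\
        bounded_on (kact (Pt t) f) setT /\
        {within V, continuous (kact (Pt t) f)}) ->
     exists g : T -> R, density_version L pi g /\
       {within V, continuous g} /\ bounded_on g V)
  /\
  (* (2) *)
  ((forall t, 0 <= t -> forall f : T -> R, bounded_continuous f ->
      (forall x, 0 <= f x) -> lsc (kact (Pt t) f)) ->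
   separable T ->
   exists rho : T -> R,
     density_version L pi rho /\ bounded_on rho setT /\ (forall x, 0 <= rho x) /\
     lsc rho /\
     forall rho' : T -> R, density_version L pi rho' -> bounded_on rho' setT ->
       (forall x, 0 <= rho' x) -> lsc rho' -> forall x, rho' x <= rho x).
Proof.
move=> _ _ Lfull _ sPt qsd dens hC.
have [f [psi [df [F fF] bpsi psi0 approx]]] :=
  density_approximation L P Pt pi sPt qsd dens hC.
have cst1 : @bounded_continuous R T (fun _ => 1).
  by split; [move=> x; exact: cvg_cst|exists 1 => x _; rewrite normr1].
split=> [V oV regular|lscP sepT].
  have [|g [mg fg cg bg]] := continuous_approximation_version L Pt f psi V Lfull oV
    df.1 bpsi approx.
    by move=> t t0; have [_ []] := regular t t0 _ cst1.
  by exists g; split => //; exact: density_version_ae fg.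
pose rho := lsc_regularization L f.
have lsc_rho : lsc rho by exact: lsc_lsc_regularization fF.
have f_rho : {ae L, forall x, f x <= rho x}.
  (* [w] lies within [1 / (n + 1)] of [f]. Lowered by this error it is a lower semicontinuous
     minorant of [f], hence at most [rho]; adding the error in [f <= w + 1 / (n + 1)] gives the
     factor two. *)
  have near_le n : {ae L, forall x, f x <= rho x + 2 / n.+1%:R}.
    have [|alpha [s [alpha0 s0 le_e]]] := approx n.+1%:R^-1.
      by rewrite invr_gt0.
    pose w x := alpha * psi x * kact (Pt s) (fun _ => 1) x.
    have lsc_w : lsc w.
      apply: lsc_mul.
      - by move=> x; apply: cvgMr; exact: bpsi.1.
      - by move=> x; rewrite mulr_gt0.
      - by apply: lscP.
      - by move=> x; rewrite /kact fine_ge0// integral_ge0.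
    have w_rho : forall x, w x - n.+1%:R^-1 <= rho x.
      apply: (lsc_le_regularization _ _ _ Lfull fF).
        exact: lsc_subr.
      by apply: ae_borelS le_e => x; rewrite ler_distl => /andP[_]; rewrite lerBlDr.
    apply: ae_borelS le_e => x; rewrite ler_distl => /andP[+ _].
    move: (w_rho x); rewrite -/(w x); move: (n.+1%:R^-1) => e; lra.
  apply: ae_borelS (ae_foralln near_le) => x fx.
  apply/ler_addgt0Pr => e e0; have e20 : 0 < e / 2 by rewrite divr_gt0.
  have [n _ /(_ n (leqnn n))/= ne] := near_infty_natSinv_lt (PosNum e20).
  apply: (le_trans (fx n)); rewrite lerD2l.
  by move: ne; move: (n.+1%:R^-1) => ?; lra.
have rho_f := lsc_regularization_ae_le L f F fF sepT.
have frho : {ae L, forall x, f x = rho x}.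
  by apply: ae_borelS2 f_rho rho_f => x le1 le2; apply/eqP; rewrite eq_le le1.
exists rho; split; first by apply: density_version_ae frho => //; exact: lsc_measurable.
split.
  exists F => x _; rewrite ger0_norm; first exact: (lsc_regularization_le L f F Lfull fF).
  exact: (lsc_regularization_ge0 L f F Lfull fF).
split; first exact: (lsc_regularization_ge0 L f F Lfull fF).
split=> // rho' drho' _ _ lsc_rho'.
(* Any other version equals [f] almost everywhere, so it is one of the minorants that [rho]
   dominates at every point. *)
apply: (lsc_le_regularization L f F Lfull fF _ lsc_rho').
by apply: ae_borelS (density_unique _ _ _ _ drho'.1 df.1 drho'.2 df.2) => x ->.
Qed.
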